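(* Let $X$ be a smooth complete toric variety with fan $\Sigma$, Cox ring $R=\mathbb{C}[x_1,\dots,x_r]$ and irrelevant ideal $B$. Let $I=(x^{m_1+k^1},\dots,x^{m_t+k^t})\subset R$ be a monomial ideal with Klyachko diagram $\{(\mathcal{C}^\sigma_I,\Delta^\sigma_I)\}_{\sigma\in\Sigma}$, where for $1\le i\le t$ the elements $m_i\in M$ and $k^i=(k^i_\rho)_{\rho\in\Sigma(1)}\in\mathbb{Z}^r$ satisfy $\langle m_i,\rho\rangle+k^i_\rho\ge0$ for all $\rho\in\Sigma(1)$. Then for any $D=(a_\rho)_{\rho\in\Sigma(1)}\in\mathbb{Z}^r$ there is an isomorphism of $\mathbb{C}$-vector spaces $$H^1_B(I)_{[D]}\cong\mathbb{C}\left\langle\Big\{x^{m+D}\ \Big|\ m\in\bigcap_{\sigma\in\Sigma_{\max}}\big(\mathcal{C}^\sigma_I(D)\setminus\Delta^\sigma_I(D)\big)\Big\}\setminus\bigcup_{i=1}^tT_D(x^{m_i+k^i})\right\rangle .$$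
   Context: Setting. $X$ is an $n$-dimensional smooth complete toric variety over $\mathbb{C}$ with fan $\Sigma\subset N\otimes\mathbb{R}$, $N\cong\mathbb{Z}^n$, $M=\mathrm{Hom}(N,\mathbb{Z})$; $\Sigma_{\max}$ is the set of maximal cones. $\Sigma(1)=\{\rho_1,\dots,\rho_r\}$ is the ordered set of rays, $\sigma(1)$ the set of rays of a cone $\sigma$, $n(\rho)\in N$ is the first nonzero lattice point on $\rho$, and $\langle m,\rho\rangle:=\langle m,n(\rho)\rangle$. The Cox ring $R=\mathbb{C}[x_1,\dots,x_r]$ has one variable $x_i=x_{\rho_i}$ per ray and is graded by $\mathrm{Cl}(X)$ via $\deg x_i=[D_{\rho_i}]$. For $D=(a_\rho)\in\mathbb{Z}^r$, $[D]=\sum_\rho a_\rho[D_\rho]\in\mathrm{Cl}(X)$, and for $m\in M$, $x^{m+D}:=\prod_\rho x_\rho^{\langle m,\rho\rangle+a_\rho}$. With $x^{\hat\sigma}=\prod_{\rho_i\notin\sigma(1)}x_i$, the irrelevant ideal is $B=\langle x^{\hat\sigma}\mid\sigma\in\Sigma\rangle$. $H^1_B(I)$ is the first local cohomology module of $I$ with support in $B$, and $(\cdot)_{[D]}$ denotes the homogeneous piece of $\mathrm{Cl}(X)$-degree $[D]$. $\mathbb{C}\langle S\rangle$ is the vector space with basis $S$. Monomials divisible by a given one. For $m\in M$ and $D=(a_\rho),E=(b_\rho)\in\mathbb{Z}^r$, $T_E(x^{m+D}):=\{x^{m'+E}\mid m'\in M,\ \langle m',\rho\rangle\ge\langle m,\rho\rangle+a_\rho-b_\rho\text{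 for all }\rho\in\Sigma(1)\}$. Klyachko diagram. Let $I=(m_1,\dots,m_t)$, $t\ge1$, be generated by monomials (here $m_i$ denotes the $i$-th monomial generator); $\deg_{\rho_j}$ of a monomial is its exponent in $x_j$. Put $s_j=s_{\rho_j}:=\min_i\deg_{\rho_j}(m_i)$. For $\sigma=\mathrm{cone}(\rho_{i_1},\dots,\rho_{i_c})$ of dimension $c$, put $\mathcal{C}^\sigma_I:=\{m\in M\mid\langle m,\rho_{i_p}\rangle\ge s_{i_p},\ 1\le p\le c\}$. For a subset $\mathcal{S}=\{n_1,\dots,n_s\}$ of the generators define $\Delta^\sigma_I(\mathcal{S})\subset\mathcal{C}^\sigma_I$ recursively: - $\Delta^\sigma_I(\emptyset):=\mathcal{C}^\sigma_I$. - If $s\ge1$ and $c=0$ (i.e. $\sigma=\{0\}$): $\Delta^\sigma_I(\mathcal{S}):=\emptyset$. - If $s\ge1$ and $c\geq 1$, order the elements so that $\deg_{\rho_{i_c}}(n_{1})\le\cdots\le\deg_{\rho_{i_c}}(n_{s})$. If $c=1$: $\Delta^\sigma_I(\mathcal{S}):=\{m\mid s_{i_1}\le\langle m,\rho_{i_1}\rangle<\deg_{\rho_{i_1}}(n_1)\}$. If $c\ge2$, put $\sigma'=\mathrm{cone}(\rho_{i_1},\dots,\rho_{i_{c-1}})$ and $\Delta^\sigma_I(\mathcal{S}):=\bigcup_{j=0}^s\Delta^\sigma_I(\mathcal{S})_j$, where $\Delta^\sigma_I(\mathcal{S})_0:=\{m\mid s_{i_c}\le\langle m,\rho_{i_c}\rangle<\deg_{\rho_{i_c}}(n_1)\}\cap\Delta^{\sigma'}_I(\emptyset)$,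 $\Delta^\sigma_I(\mathcal{S})_j:=\{m\mid\deg_{\rho_{i_c}}(n_j)\le\langle m,\rho_{i_c}\rangle<\deg_{\rho_{i_c}}(n_{j+1})\}\cap\Delta^{\sigma'}_I(\{n_1,\dots,n_j\})$ for $1\le j\le s-1$, $\Delta^\sigma_I(\mathcal{S})_s:=\{m\mid\deg_{\rho_{i_c}}(n_s)\le\langle m,\rho_{i_c}\rangle\}\cap\Delta^{\sigma'}_I(\{n_1,\dots,n_s\})$. Finally $\Delta^\sigma_I:=\Delta^\sigma_I(\text{all generators})$. The collection $\{(\mathcal{C}^\sigma_I,\Delta^\sigma_I)\}_{\sigma\in\Sigma}$ is the Klyachko diagram of $I$. Shifts. For $D=(a_\rho)\in\mathbb{Z}^r$ and $\sigma\in\Sigma$, choose $\tau_\sigma\in M$ with $\langle\tau_\sigma,\rho\rangle=a_\rho$ for all $\rho\in\sigma(1)$ (possible since $X$ is smooth). Then $\mathcal{C}^\sigma_I(D):=\mathcal{C}^\sigma_I-\tau_\sigma=\{m\in M\mid m+\tau_\sigma\in\mathcal{C}^\sigma_I\}$ and $\Delta^\sigma_I(D):=\Delta^\sigma_I-\tau_\sigma$. *)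

(* Defs.v *)
From HB Require Import structures.
From mathcomp Require Import all_boot all_order all_algebra.
From mathcomp Require Import boolp reals complex.
From mathcomp Require Import freeg mpoly.

Set Implicit Arguments.
Unset Strict Implicit.
Unset Printing Implicit Defensive.

Import Order.TTheory GRing.Theory Num.Theory.
Local Open Scope ring_scope.

Section SubQuotient.
Variables (K : nzRingType) (V : lmodType K).

Definition subm (P : submodClosed V) : Type := {x : V | x \in P}.
HB.instance Definition _ (P : submodClosed V) :=
  SubChoice.copy (subm P) {x : V | x \in P}.
HB.instance Definition _ (P : submodClosed V) :=
  [SubChoice_isSubLmodule of subm P by <:].

Definition lpred (P : submodClosed V) : {pred V} := [pred x | x \in P].
Fact lpred_zmod (P : submodClosed V) : zmod_closed (lpred P).
Proof.
split=> [|x y xP yP]; rewrite /lpred inE; first exact: rpred0.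
by apply: rpredD => //; rewrite -scaleN1r; apply: rpredZ.
Qed.
HB.instance Definition _ (P : submodClosed V) :=
  GRing.isZmodClosed.Build V (lpred P) (lpred_zmod P).

Definition lquot (P : submodClosed V) : Type := Quotient.quot (lpred P).
HB.instance Definition _ (P : submodClosed V) := GRing.Zmodule.on (lquot P).

Section Scale.
Variable P : submodClosed V.
Local Notation pi := (\pi_(Quotient.quot (lpred P)))%qT.

Definition lquot_scale (c : K) (x : lquot P) : lquot P := pi (c *: (repr x : V)).

Fact lquot_scale_pi c (x : V) : lquot_scale c (pi x) = pi (c *: x).
Proof.
apply/eqP; rewrite /lquot_scale -Quotient.idealrBE -scalerBr inE.
by apply: rpredZ; have := Quotient.idealrBE (lpred P) (repr (pi x)) x;
  rewrite inE reprK eqxx.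
Qed.

Fact lquot_ind (Q : lquot P -> Prop) : (forall x : V, Q (pi x)) -> forall x, Q x.
Proof. by move=> H x; rewrite -[x]reprK; apply: H. Qed.

Fact lquot_scaleA a b v : lquot_scale a (lquot_scale b v) = lquot_scale (a * b) v.
Proof. by elim/lquot_ind: v => v; rewrite !lquot_scale_pi scalerA. Qed.
Fact lquot_scale1 : left_id 1 lquot_scale.
Proof. by elim/lquot_ind=> v; rewrite lquot_scale_pi scale1r. Qed.
Fact lquot_scaleDr : right_distributive lquot_scale +%R.
Proof.
move=> a; elim/lquot_ind=> u; elim/lquot_ind=> v.
by rewrite -[_ + _](raddfD pi) !lquot_scale_pi scalerDr raddfD.
Qed.
Fact lquot_scaleDl v : {morph lquot_scale^~ v : a b / a + b}.
Proof.
by elim/lquot_ind: v => v a b; rewrite !lquot_scale_pi scalerDl raddfD.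
Qed.
HB.instance Definition _ := GRing.Zmodule_isLmodule.Build K (lquot P)
  lquot_scaleA lquot_scale1 lquot_scaleDr lquot_scaleDl.
End Scale.
End SubQuotient.

Section FreeSpace.
Variables (K : nzRingType) (T : choiceType) (S : T -> Prop).

Definition supported_in : {pred {freeg T / K}} :=
  [pred f | `[< forall w, coeff w f != 0 -> S w >]].
Fact supported_in_submod : submod_closed supported_in.
Proof.
split=> [|a f g /asboolP fS /asboolP gS]; apply/asboolP=> w.
  by rewrite coeff0 eqxx.
rewrite coeffD coeffZ => fgw.
have [gw|/gS //] := eqVneq (coeff w g) 0.
have [fw|/fS //] := eqVneq (coeff w f) 0.
by rewrite fw gw mulr0 addr0 eqxx in fgw.
Qed.
HB.instance Definition _ :=
  GRing.isSubmodClosed.Build K ({freeg T / K}) supported_in supported_in_submod.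

(* the K-vector space with basis S *)
Definition free_space : lmodType K := subm supported_in.
End FreeSpace.

Section RestrictScalars.
Variables (K : comNzRingType) (r : nat) (E : lmodType {mpoly K[r]}).

Definition restr : Type := E.
HB.instance Definition _ := GRing.Zmodule.on restr.
Definition restr_scale (c : K) (v : restr) : restr := (c%:MP : {mpoly K[r]}) *: (v : E).
Fact restr_scaleA a b v : restr_scale a (restr_scale b v) = restr_scale (a * b) v.
Proof. by rewrite /restr_scale scalerA -mpolyCM. Qed.
Fact restr_scale1 : left_id 1 restr_scale.
Proof. by move=> v; rewrite /restr_scale scale1r. Qed.
Fact restr_scaleDr : right_distributive restr_scale +%R.
Proof. by move=> a u v; rewrite /restr_scale scalerDr. Qed.
Fact restr_scaleDl v : {morph restr_scale^~ v : a b / a + b}.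
Proof. by move=> a b; rewrite /restr_scale mpolyCD scalerDl. Qed.
HB.instance Definition _ := GRing.Zmodule_isLmodule.Build K restr
  restr_scaleA restr_scale1 restr_scaleDr restr_scaleDl.
End RestrictScalars.

Section Ideals.
Variables (A : comNzRingType).

(* the ideal generated by the elements of S *)
Definition ideal_gen (S : A -> Prop) (f : A) : Prop :=
  exists2 l : seq (A * A),
    (forall p, p \in l -> S p.2) & f = \sum_(p <- l) p.1 * p.2.

Definition ideal_pow (J : A -> Prop) (k : nat) : A -> Prop :=
  ideal_gen (fun f => exists2 b : 'I_k -> A,
    (forall i, J (b i)) & f = \prod_i b i).

Lemma ideal_gen0 S : ideal_gen S 0.
Proof. by exists [::]; rewrite ?big_nil. Qed.

Lemma ideal_genD S f g : ideal_gen S f -> ideal_gen S g -> ideal_gen S (f + g).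
Proof.
move=> [l lS ->] [l' lS' ->]; exists (l ++ l'); last by rewrite big_cat.
by move=> p; rewrite mem_cat => /orP[/lS|/lS'].
Qed.

Lemma ideal_genM S a f : ideal_gen S f -> ideal_gen S (a * f).
Proof.
move=> [l lS ->]; exists [seq (a * p.1, p.2) | p <- l].
  by move=> p /mapP[q /lS ? ->].
by rewrite big_map mulr_sumr; apply: eq_bigr => p _; rewrite mulrA.
Qed.

Lemma ideal_gen_sum S (I : Type) (s : seq I) (P : pred I) (F : I -> A) :
  (forall i, P i -> ideal_gen S (F i)) -> ideal_gen S (\sum_(i <- s | P i) F i).
Proof.
by move=> H; apply: (big_ind (ideal_gen S)) => //;
  [exact: ideal_gen0|exact: ideal_genD].
Qed.

Lemma ideal_gen_mem (S : A -> Prop) f : S f -> ideal_gen S f.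
Proof.
move=> Sf; exists [:: (1, f)]; last by rewrite big_seq1 mul1r.
by move=> p; rewrite inE => /eqP->.
Qed.

Lemma ideal_pow_le J k l f : (k <= l)%N -> ideal_pow J l f -> ideal_pow J k f.
Proof.
move=> /subnKC <- [s sJ ->]; rewrite big_seq; apply: ideal_gen_sum => p /sJ[b bJ ->].
apply: ideal_genM; rewrite big_split_ord /= mulrC; apply: ideal_genM.
by apply: ideal_gen_mem; exists (fun i => b (lshift _ i)).
Qed.

(* the J-power torsion submodule of a module *)
Definition Gamma (J : A -> Prop) (E : lmodType A) (e : E) : Prop :=
  exists k, forall f, ideal_pow J k f -> f *: e = 0.

Lemma Gamma0 J (E : lmodType A) : @Gamma J E 0.
Proof. by exists 0 => f _; rewrite scaler0. Qed.

Lemma GammaD J (E : lmodType A) (x y : E) :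
  Gamma J x -> Gamma J y -> Gamma J (x + y).
Proof.
move=> [k kx] [l ly]; exists (maxn k l) => f fJ.
by rewrite scalerDr kx ?ly ?addr0 //; apply: ideal_pow_le fJ;
  rewrite ?leq_maxl ?leq_maxr.
Qed.

Lemma GammaZ J (E : lmodType A) a (x : E) : Gamma J x -> Gamma J (a *: x).
Proof.
by move=> [k kx]; exists k => f /kx fx; rewrite scalerA mulrC -scalerA fx scaler0. Qed.

Variable S : A -> Prop.
Definition ideal_pred : {pred A^o} := [pred f | `[< ideal_gen S f >]].
Fact ideal_pred_submod : submod_closed ideal_pred.
Proof.
split=> [|a f g /asboolP fS /asboolP gS]; apply/asboolP; first exact: ideal_gen0.
by apply: ideal_genD => //; apply: ideal_genM.
Qed.
HB.instance Definition _ :=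
  GRing.isSubmodClosed.Build A A^o ideal_pred ideal_pred_submod.

(* the ideal generated by S, as a module *)
Definition ideal_mod : lmodType A := subm ideal_pred.
End Ideals.

Section Graded.
Variables (K : fieldType) (r : nat) (G : zmodType) (dg : 'I_r -> G).
Local Notation R := {mpoly K[r]}.

(* the grading of R with deg x_i = dg i *)
Definition mon_degree (m : 'X_{1..r}) : G := \sum_i dg i *+ m i.
Definition homogeneous (g : G) (f : R) : Prop :=
  forall m, m \in msupp f -> mon_degree m = g.

(* E is the direct sum of the subgroups piece g, and R_g E_h is in E_(g+h);
   the pieces are K-subspaces because constants are homogeneous of degree 0 *)
Record is_grading (E : lmodType R) (piece : G -> E -> Prop) : Prop := IsGrading {
  grading0 : forall g, piece g 0;
  gradingD : forall g x y, piece g x -> piece g y -> piece g (x + y);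
  gradingZ : forall g h a x, homogeneous g a -> piece h x -> piece (g + h) (a *: x);
  grading_span : forall x, exists s : seq G, exists2 f : G -> E,
    (forall g, piece g (f g)) & x = \sum_(g <- s) f g;
  grading_direct : forall (s : seq G) (f : G -> E), uniq s ->
    (forall g, piece g (f g)) -> \sum_(g <- s) f g = 0 ->
    forall g, g \in s -> f g = 0 }.

Record gradedModule := GradedModule {
  gmod_sort :> lmodType R;
  gpiece : G -> gmod_sort -> Prop;
  gpieceP : is_grading gpiece }.

Definition graded_hom (E F : gradedModule) (f : {linear E -> F}) : Prop :=
  forall g x, gpiece g x -> gpiece g (f x).

(* injective objects of the category of graded modules and degree 0 maps *)
Definition graded_injective (E : gradedModule) : Prop :=
  forall (A B : gradedModule) (i : {linear A -> B}) (f : {linear A -> E}),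
    graded_hom i -> graded_hom f -> injective i ->
    exists2 h : {linear B -> E}, graded_hom h & forall a, h (i a) = f a.

(* 0 -> M -> E^0 -> E^1 -> E^2 -> ...; such resolutions always exist, the
   category of graded modules having enough injectives *)
Record injective_resolution (M : gradedModule) := InjectiveResolution {
  res_obj : nat -> gradedModule;
  res_aug : {linear M -> res_obj 0};
  res_d : forall i, {linear res_obj i -> res_obj i.+1};
  res_injective : forall i, graded_injective (res_obj i);
  res_aug_hom : graded_hom res_aug;
  res_d_hom : forall i, graded_hom (res_d i);
  res_aug_inj : injective res_aug;
  res_exact0 : forall e, res_d 0 e = 0 <-> exists x, res_aug x = e;
  res_exactS : forall i e, res_d i.+1 e = 0 <-> exists e', res_d i e' = e }.

Section LocalCohomology.
Variables (J : R -> Prop) (M : gradedModule) (E : injective_resolution M).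

Definition lc_cocycle (i : nat) (g : G) : {pred restr (res_obj E i)} :=
  [pred e | `[< [/\ gpiece g (e : res_obj E i), Gamma J (e : res_obj E i)
                  & res_d E i e = 0] >]].

Arguments lc_cocycle : clear implicits.

Definition lc_coboundary (i : nat) (g : G) : res_obj E i -> Prop :=
  match i with
  | 0 => fun e => e = 0
  | i'.+1 => fun e => exists e' : res_obj E i',
      [/\ gpiece g e', Gamma J e' & res_d E i' e' = e]
  end.

Lemma homogeneousC c : homogeneous 0 (c%:MP : R).
Proof.
move=> m; rewrite msuppC; case: eqP => // _; rewrite inE => /eqP->.
by rewrite /mon_degree big1 // => i _; rewrite mnm0E mulr0n.
Qed.

Lemma gpieceC (F : gradedModule) g c (x : F) :
  gpiece g x -> gpiece g ((c%:MP : R) *: x).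
Proof.
by move=> xg; rewrite -[g]add0r; apply: (gradingZ (gpieceP F)) => //; apply: homogeneousC. Qed.

Fact lc_cocycle_submod i g : submod_closed (lc_cocycle i g).
Proof.
split=> [|a x y /asboolP[xg xJ dx] /asboolP[yg yJ dy]]; apply/asboolP.
  by split; [exact: (grading0 (gpieceP _))|exact: Gamma0|rewrite linear0].
split.
- by apply: (gradingD (gpieceP _)) => //; apply: gpieceC.
- by apply: GammaD yJ; apply: GammaZ.
- have -> : a *: x + y = (a%:MP : R) *: (x : res_obj E i) + (y : res_obj E i) by [].
  by rewrite linearP dx dy scaler0 addr0.
Qed.
HB.instance Definition _ i g := GRing.isSubmodClosed.Build K
  (restr (res_obj E i)) (lc_cocycle i g) (lc_cocycle_submod i g).

Definition lc_boundary (i : nat) (g : G) : {pred subm (lc_cocycle i g)} :=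
  [pred z | `[< lc_coboundary g (val z : res_obj E i) >]].
Arguments lc_boundary : clear implicits.

Fact lc_boundary_submod i g : submod_closed (lc_boundary i g).
Proof.
split=> [|a x y /asboolP xb /asboolP yb]; apply/asboolP.
  change (lc_coboundary g (0 : res_obj E i)).
  case: i => [|i] //=; exists 0.
  by split; [exact: (grading0 (gpieceP _))|exact: Gamma0|rewrite linear0].
change (lc_coboundary g
  ((a%:MP : R) *: (val x : res_obj E i) + (val y : res_obj E i))).
case: i x y xb yb => [|i] x y /=.
  by move=> -> ->; rewrite scaler0 addr0.
move=> [x' [xg xJ dx]] [y' [yg yJ dy]]; exists ((a%:MP : R) *: x' + y'); split.
- by apply: (gradingD (gpieceP _)) => //; apply: gpieceC.
- by apply: GammaD yJ; apply: GammaZ.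
- by rewrite linearP dx dy.
Qed.
HB.instance Definition _ i g := GRing.isSubmodClosed.Build K
  (subm (lc_cocycle i g)) (lc_boundary i g) (lc_boundary_submod i g).

(* the degree g piece of H^i_J(M), the i-th right derived functor of Gamma_J
   on graded modules: the degree g strand of the cohomology of the complex
   Gamma_J(E^0) -> Gamma_J(E^1) -> ... *)
Definition local_cohomology (i : nat) (g : G) : lmodType K :=
  lquot (lc_boundary i g).
End LocalCohomology.

Section HomogeneousIdeal.
Variables (S : R -> Prop).
Hypothesis homS : forall f, S f -> exists g, homogeneous g f.

Definition ideal_piece (g : G) (f : ideal_mod S) : Prop :=
  homogeneous g (val f : R).

Definition homog_part (g : G) (f : R) : R :=
  \sum_(m <- msupp f | mon_degree m == g) f@_m *: 'X_[m].

Lemma homog_partE g f m : (homog_part g f)@_m = f@_m *+ (mon_degree m == g).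
Proof.
rewrite /homog_part raddf_sum /= big_mkcond.
have [mf|mf] := boolP (m \in msupp f); last first.
  rewrite (memN_msupp_eq0 mf) mul0rn big_seq big1 // => m' m'f.
  case: ifP => // _; rewrite mcoeffZ mcoeffX.
  by have [e|] := eqVneq m' m; rewrite ?mulr0 // -e m'f in mf *.
rewrite (bigD1_seq m) ?msupp_uniq //= big1 ?addr0 => [|m' ne].
  by case: (mon_degree m == g); rewrite ?mulr0n ?mulr1n //
    mcoeffZ mcoeffX eqxx mulr1.
by case: ifP => // _; rewrite mcoeffZ mcoeffX (negPf ne) mulr0.
Qed.

Lemma homog_part_homog g f : homogeneous g (homog_part g f).
Proof.
by move=> m; rewrite mcoeff_msupp homog_partE; case: (mon_degree m =P g) => // _; rewrite mulr0n eqxx.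
Qed.

Lemma homog_partD g f f' : homog_part g (f + f') = homog_part g f + homog_part g f'.
Proof. by apply/mpolyP=> m; rewrite mcoeffD !homog_partE mcoeffD mulrnDl. Qed.

Lemma homog_part0 g : homog_part g 0 = 0.
Proof. by apply/mpolyP=> m; rewrite homog_partE !mcoeff0 mul0rn. Qed.

Lemma homog_part_sum g (I : Type) (s : seq I) (F : I -> R) :
  homog_part g (\sum_(i <- s) F i) = \sum_(i <- s) homog_part g (F i).
Proof. exact: (big_morph _ (homog_partD g) (homog_part0 g)). Qed.

Lemma mon_degreeD m m' : mon_degree (m + m')%MM = mon_degree m + mon_degree m'.
Proof. by rewrite -big_split; apply: eq_bigr => i _; rewrite mnmDE mulrnDr. Qed.

Lemma homog_id g f : homogeneous g f -> homog_part g f = f.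
Proof.
move=> fg; apply/mpolyP=> m; rewrite homog_partE.
have [/fg->|mf] := boolP (m \in msupp f); first by rewrite eqxx.
by rewrite (memN_msupp_eq0 mf) mul0rn.
Qed.

Lemma homog_ne g h f : g != h -> homogeneous h f -> homog_part g f = 0.
Proof.
move=> ne fh; apply/mpolyP=> m; rewrite homog_partE mcoeff0.
have [/fh->|mf] := boolP (m \in msupp f); first by rewrite eq_sym (negPf ne).
by rewrite (memN_msupp_eq0 mf) mul0rn.
Qed.

Lemma homogeneousM g h a f :
  homogeneous g a -> homogeneous h f -> homogeneous (g + h) (a * f).
Proof.
move=> ag fh m /msuppM_le /allpairsP[[m1 m2] /= [/ag <- /fh <- ->]].
by rewrite mon_degreeD.
Qed.

Lemma homog_part_seq f (s : seq G) :
  uniq s -> (forall m, m \in msupp f -> mon_degree m \in s) ->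
  f = \sum_(g <- s) homog_part g f.
Proof.
move=> us fs; apply/mpolyP=> m; rewrite raddf_sum /=.
under eq_bigr do rewrite homog_partE.
have [/fs ms|mf] := boolP (m \in msupp f); last first.
  by rewrite (memN_msupp_eq0 mf) big1 // => g _; rewrite mul0rn.
rewrite (bigD1_seq _ ms us) /= eqxx big1 ?addr0 // => g.
by rewrite eq_sym => /negPf->.
Qed.

Lemma homog_partM g h a f :
  homogeneous h f -> homog_part g (a * f) = homog_part (g - h) a * f.
Proof.
move=> fh; pose s := undup [seq mon_degree m | m <- msupp a].
have sa m : m \in msupp a -> mon_degree m \in s.
  by move=> ma; rewrite mem_undup map_f.
rewrite {1}(homog_part_seq (undup_uniq _) sa) mulr_suml homog_part_sum.
have E g' : homog_part g (homog_part g' a * f)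
    = if g' == g - h then homog_part g' a * f else 0.
  have H := homogeneousM (@homog_part_homog g' a) fh.
  case: eqP => [e|ne]; first by rewrite e subrK in H *; rewrite homog_id.
  by apply: homog_ne H; apply/eqP=> e; apply: ne; rewrite e addrK.
under eq_bigr do rewrite E.
have [ins|nins] := boolP (g - h \in s).
  rewrite (bigD1_seq _ ins (undup_uniq _)) /= eqxx big1 ?addr0 // => g'.
  by move=> /negPf->.
rewrite big_seq big1 => [|g' g's]; last first.
  by case: eqP => // e; rewrite -e g's in nins.
suff -> : homog_part (g - h) a = 0 by rewrite mul0r.
apply/mpolyP=> m; rewrite homog_partE mcoeff0.
have [ma|ma] := boolP (m \in msupp a); last by rewrite (memN_msupp_eq0 ma) mul0rn.
by case: eqP => // e; rewrite -e sa in nins.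
Qed.

Lemma ideal_homog_part g f : ideal_gen S f -> ideal_gen S (homog_part g f).
Proof.
move=> [l lS ->]; rewrite homog_part_sum big_seq; apply: ideal_gen_sum => p /lS Sp.
have [h ph] := homS Sp; rewrite (homog_partM _ _ ph); apply: ideal_genM.
exact: ideal_gen_mem.
Qed.

Fact ideal_piece_grading : is_grading ideal_piece.
Proof.
have part_mem g (x : ideal_mod S) : (homog_part g (val x : R) : R^o) \in ideal_pred S.
  by apply/asboolP; apply: ideal_homog_part; have /asboolP := valP x.
split.
- by move=> g m; rewrite /= msupp0.
- by move=> g x y xg yg m /msuppD_le; rewrite mem_cat => /orP[/xg|/yg].
- by move=> g h a x ag xh; apply: homogeneousM.
- move=> x; exists (undup [seq mon_degree m | m <- msupp (val x : R)]).
  exists (fun g => Sub (homog_part g (val x : R) : R^o) (part_mem g x)) => [g|].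
    by rewrite /ideal_piece SubK; apply: homog_part_homog.
  apply: val_inj; rewrite raddf_sum /=.
  by apply: homog_part_seq (undup_uniq _) _ => m mx; rewrite mem_undup map_f.
- move=> s f us fp /(congr1 (fun x : ideal_mod S => (val x : R))).
  rewrite raddf_sum /= => f0 g gs; apply: val_inj => /=.
  have := congr1 (homog_part g) f0.
  rewrite homog_part_sum (bigD1_seq g) //= big1 => [|h ne]; last first.
    by apply: homog_ne (fp h); rewrite eq_sym.
  by rewrite addr0 homog_part0 homog_id //; apply: fp.
Qed.

Definition homogeneous_ideal : gradedModule := GradedModule ideal_piece_grading.
End HomogeneousIdeal.
End Graded.

Section Cones.
Variables (R : realType) (n r : nat) (u : 'I_r -> 'rV[int]_n).

Definition cone_over (s : {set 'I_r}) (v : 'rV[R]_n) : Prop :=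
  exists2 c : 'I_r -> R, (forall i, 0 <= c i)
    & v = \sum_(i in s) c i *: map_mx intr (u i).

(* F is cut out in C by a linear form that is nonnegative on C *)
Definition is_face (F C : 'rV[R]_n -> Prop) : Prop :=
  exists2 m : 'cV[R]_n, (forall v, C v -> 0 <= (v *m m) 0 0)
    & forall v, F v <-> C v /\ (v *m m) 0 0 = 0.

(* the vectors u i, i in s, are distinct members of a Z-basis of Z^n *)
Definition part_of_basis (s : {set 'I_r}) : Prop :=
  exists2 P : 'M[int]_n, P \in unitmx
    & exists2 f : 'I_r -> 'I_n, {in s &, injective f}
        & forall i, i \in s -> row (f i) P = u i.
End Cones.

(* A smooth complete fan in N_R with N = Z^n and M = Hom(N, Z) written as
   column vectors. A cone is given by the set of (indices of) its rays; the
   vector ray i is n(rho_i), primitive because [set i] is a smooth cone. *)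
Record smoothCompleteFan (R : realType) (n r : nat) := SmoothCompleteFan {
  ray : 'I_r -> 'rV[int]_n;
  cones : {set {set 'I_r}};
  ray_inj : injective ray;
  ray_cone : forall i, [set i] \in cones;
  face_cone : forall s (F : 'rV[R]_n -> Prop), s \in cones ->
    is_face F (cone_over ray s) ->
    exists2 t, t \in cones & forall v, F v <-> cone_over ray t v;
  meet_cone : forall s t, s \in cones -> t \in cones ->
    is_face (fun v : 'rV[R]_n => cone_over ray s v /\ cone_over ray t v)
            (cone_over ray s);
  smooth_cone : forall s, s \in cones -> part_of_basis ray s;
  complete_fan : forall v : 'rV[R]_n,
    exists2 s, s \in cones & cone_over ray s v }.

Section Toric.
Variables (R : realType) (n r : nat) (X : smoothCompleteFan R n r).
Local Notation M := 'cV[int]_n.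
Local Notation Zr := {ffun 'I_r -> int}.
Local Notation cox := {mpoly R[i][r]}.

Definition pairing (m : M) (i : 'I_r) : int := (ray X i *m m) 0 0.

Definition max_cones : {set {set 'I_r}} :=
  [set s in cones X | maxset (mem (cones X)) s].

Definition principal : {pred Zr} :=
  [pred D | `[< exists m : M, D = [ffun i => pairing m i] >]].
Fact principal_zmod : zmod_closed principal.
Proof.
split=> [|_ _ /asboolP[m ->] /asboolP[m' ->]]; apply/asboolP.
  by exists 0; apply/ffunP=> i; rewrite !ffunE /pairing mulmx0 mxE.
by exists (m - m'); apply/ffunP=> i; rewrite !ffunE /pairing mulmxBr !mxE.
Qed.
HB.instance Definition _ := GRing.isZmodClosed.Build Zr principal principal_zmod.

Definition Cl : zmodType := Quotient.quot principal.
Definition div_class (D : Zr) : Cl := (\pi_(Quotient.quot principal) D)%qT.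
Definition var_degree (i : 'I_r) : Cl := div_class [ffun j => (j == i)%:Z].

Definition irrelevant_ideal : cox -> Prop :=
  ideal_gen (fun f => exists2 s, s \in cones X & f = \prod_(i | i \notin s) 'X_i).

(* the exponent vector of x^(m+D), which stands for that Laurent monomial *)
Definition laurent (m : M) (D : Zr) : Zr := [ffun i => pairing m i + D i].

(* T_E(x^(m+D)) *)
Definition Tset (E : Zr) (m : M) (D : Zr) (w : Zr) : Prop :=
  exists2 m' : M, w = laurent m' E
    & forall i, pairing m' i >= pairing m i + D i - E i.

(* x^(m+D) as a monomial of the Cox ring, when its exponents are nonnegative *)
Definition cox_monomial (m : M) (D : Zr) : 'X_{1..r} :=
  [multinom `|laurent m D i|%N | i < r].

Definition generators t (m : 'I_t -> M) (k : 'I_t -> Zr) : seq 'X_{1..r} :=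
  [seq cox_monomial (m i) (k i) | i : 'I_t].

Section Klyachko.
Variable gens : seq 'X_{1..r}.

Definition monomial_gens (f : cox) : Prop :=
  exists2 g, g \in gens & f = 'X_[g].
Fact monomial_gens_homogeneous f :
  monomial_gens f -> exists g, homogeneous var_degree g f.
Proof.
move=> [g _ ->]; exists (mon_degree var_degree g) => m.
by rewrite msuppX inE => /eqP->.
Qed.
(* the ideal of the Cox ring generated by gens, as a Cl-graded module *)
Definition monomial_ideal : gradedModule R[i] var_degree :=
  homogeneous_ideal monomial_gens_homogeneous.

Definition min_exp (i : 'I_r) : nat :=
  \big[minn/head 0%MM gens i]_(g <- gens) g i.

(* In Cset_seq and Delta_seq the list of rays is i_c, ..., i_1, last ray first. *)
Definition Cset_seq (l : seq 'I_r) (m : M) : bool :=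
  all (fun i => (min_exp i)%:Z <= pairing m i) l.

Fixpoint Delta_seq (l : seq 'I_r) (S : seq 'X_{1..r}) (m : M) : bool :=
  if S is [::] then Cset_seq l m else
  if l is i :: l' then
    let S' := sort (fun a b : 'X_{1..r} => (a i <= b i)%N) S in
    (* d j = deg (n_(j+1)) along the ray i *)
    let d j : int := (nth 0%MM S' j : 'X_{1..r}) i in
    let a := pairing m i in
    if l' is [::] then (min_exp i)%:Z <= a < d 0 else
    [|| ((min_exp i)%:Z <= a < d 0) && Delta_seq l' [::] m,
        [exists j : 'I_(size S), [&& (0 < j)%N, d j.-1 <= a < d j
                                   & Delta_seq l' (take j S') m]]
      | (d (size S).-1 <= a) && Delta_seq l' S' m]
  else false.

Definition Cset (s : {set 'I_r}) (m : M) : bool := Cset_seq (rev (enum s)) m.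
Definition Delta (s : {set 'I_r}) (m : M) : bool :=
  Delta_seq (rev (enum s)) gens m.

Definition Cset_shift (tau : M) (s : {set 'I_r}) (m : M) : bool := Cset s (m + tau).
Definition Delta_shift (tau : M) (s : {set 'I_r}) (m : M) : bool := Delta s (m + tau).
End Klyachko.
End Toric.

(* Main.v *)
From HB Require Import structures.
Require Import Defs.
From mathcomp Require Import all_boot all_order all_algebra.
From mathcomp Require Import boolp reals complex.
From mathcomp Require Import freeg mpoly zify.

(** Let L be the ring of Laurent polynomials C[x_1^+-1, ..., x_r^+-1], graded by
    Cl(X). Each x^sigma-hat lies in B and acts invertibly on L, so L has no
    local cohomology, and the sequence 0 -> I -> L -> L / I -> 0 identifies
    H^1_B(I)_[D] with the degree [D] part of the B-power torsion of L / I, that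
    is with { f in L_[D] | B^k f <= I for some k } modulo I_[D]. For an
    arbitrary graded injective resolution E of I this is proved by extending
    the augmentation I -> E^0 to h : L -> E^0 and sending f to the class of
    d0 (h f) ([local_cohomology1_complement]).

    Both I and this saturation are spanned by Laurent monomials, so the quotient
    has as basis the monomials of degree [D] that lie in the saturation but not
    in I. The monomials of degree [D] are the x^(m+D) ([div_class_eqP]). Such a
    monomial x^w is in I when w dominates some generator, that is when x^w is in
    some T_D ([generatorsP]). It is in the saturation when, for every cone
    sigma, w dominates some generator along the rays of sigma
    ([monomial_saturation]), and it is enough to test maximal cones. Finally,
    the recursive description of Delta^sigma inside C^sigma is that of the m
    dominating no generator along the rays of sigma ([Cset_minus_Delta]), so
    the last condition says that m lies in C^sigma(D) minus Delta^sigma(D). *)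

Set Implicit Arguments.
Unset Strict Implicit.
Unset Printing Implicit Defensive.

Import Order.TTheory GRing.Theory Num.Theory.
Local Open Scope ring_scope.

(** * Linear algebra of quotients and ideal powers *)

Lemma bijective_of_inj_surj (T : choiceType) (U : Type) (f : T -> U) :
  injective f -> (forall y, exists x, f x = y) -> bijective f.
Proof.
move=> f_inj f_surj.
have [g gP] := boolp.choice f_surj.
by exists g => // x; apply: f_inj; rewrite gP.
Qed.

Lemma linear_inverse (K : nzRingType) (V W : lmodType K) (f : {linear V -> W}) :
  injective f -> (forall y, exists x, f x = y) ->
  exists g : {linear W -> V}, bijective g.
Proof.
move=> f_inj f_surj.
have [g fK gK] := bijective_of_inj_surj f_inj f_surj.
have g_lin : linear g by move=> a x y; apply: f_inj; rewrite linearP !gK.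
pose gM := GRing.isLinear.Build K W V *:%R g g_lin.
pose gL : {linear W -> V} := HB.pack g gM.
by exists gL; exists f.
Qed.

Lemma lquot_pi_linear (K : nzRingType) (V : lmodType K) (P : submodClosed V) :
  linear (\pi_(Quotient.quot (lpred P))%qT : V -> lquot P).
Proof.
move=> a x y; pose pi := (\pi_(Quotient.quot (lpred P)))%qT.
have -> : a *: (pi x : lquot P) = pi (a *: x) by exact: lquot_scale_pi.
exact: (raddfD pi).
Qed.

Lemma lquot_pi_eq0 (K : nzRingType) (V : lmodType K) (P : submodClosed V) (x : V) :
  ((\pi_(Quotient.quot (lpred P)) x)%qT = 0 :> lquot P) <-> x \in P.
Proof.
have E := Quotient.idealrBE (lpred P) x 0; rewrite subr0 inE in E.
rewrite -(raddf0 (\pi_(Quotient.quot (lpred P)))%qT) E; split; first by move=> ->.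
by move/eqP.
Qed.

Lemma ideal_pow_exp (A : comNzRingType) (J : A -> Prop) b k :
  J b -> ideal_pow J k (b ^+ k).
Proof.
move=> Jb; apply: ideal_gen_mem; exists (fun=> b) => //.
by rewrite prodr_const card_ord.
Qed.

(** * Decomposing elements of graded modules *)

Section GradedModules.
Variables (K : fieldType) (r : nat) (G : zmodType) (dg : 'I_r -> G).
Local Notation R := {mpoly K[r]}.

Lemma gpieceN (F : gradedModule K dg) g (x : F) : gpiece g x -> gpiece g (- x).
Proof. by move=> xg; rewrite -scaleN1r -mpolyC1 -mpolyCN; apply: gpieceC. Qed.

Lemma gpieceMn (F : gradedModule K dg) g (x : F) n :
  gpiece g x -> gpiece g (x *+ n).
Proof.
move=> xg; elim: n => [|n IHn]; first by rewrite mulr0n; apply: grading0 (gpieceP F) _.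
by rewrite mulrS; apply: gradingD (gpieceP F) _ _ _ _ _.
Qed.

(** The grading axioms provide a decomposition along a list of degrees that may
    repeat or miss the degree of interest; merging the repetitions and adding
    that degree makes the directness axiom applicable to it. *)
Lemma homogeneous_decomposition (F : gradedModule K dg) g (x : F) :
  exists s : seq G, exists f : G -> F,
    [/\ uniq s, g \in s, forall h, gpiece h (f h) & x = \sum_(h <- s) f h].
Proof.
have [s [f fp ->]] := grading_span (gpieceP F) x.
pose f' h := f h *+ count_mem h s.
have E : \sum_(h <- s) f h = \sum_(h <- undup s) f' h.
  rewrite -big_undup_iterop_count; apply: eq_bigr => h _.
  by rewrite Monoid.iteropE iter_addr_0.
have f'p h : gpiece h (f' h) by apply: gpieceMn.
have [gs|gs] := boolP (g \in s).
  by exists (undup s), f'; rewrite mem_undup undup_uniq.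
exists (g :: undup s), f'; split=> //; first by rewrite /= mem_undup gs undup_uniq.
  by rewrite mem_head.
by rewrite big_cons /f' (count_memPn gs) mulr0n add0r.
Qed.

(** Replacing x by its component of degree g changes none of the degree g part
    of its image, and the image has no other part. *)
Lemma graded_hom_preimage (F F' : gradedModule K dg) (phi : {linear F -> F'}) g x :
  graded_hom phi -> gpiece g (phi x) -> exists2 y, gpiece g y & phi y = phi x.
Proof.
move=> phiG gx; have [s [f [us gs fp xE]]] := homogeneous_decomposition g x.
exists (f g) => //.
pose F0 h := phi (f h) - (if h == g then phi x else 0).
suff /eqP : F0 g = 0 by rewrite /F0 eqxx subr_eq0 => /eqP.
apply: (grading_direct (gpieceP F') us (f := F0)) (gs) => [h|].
  rewrite /F0; apply: gradingD (gpieceP F') _ _ _ _ _; first exact: phiG.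
  apply: gpieceN; case: eqP => [->//|_]; exact: grading0 (gpieceP F') _.
rewrite sumrB -raddf_sum -xE (bigD1_seq g) //=.
by rewrite eqxx big1 ?addr0 ?subrr // => h /negPf->.
Qed.

Lemma graded_hom_inj_piece (F F' : gradedModule K dg) (phi : {linear F -> F'}) g x :
  graded_hom phi -> injective phi -> gpiece g (phi x) -> gpiece g x.
Proof. by move=> phiG phiI /(graded_hom_preimage phiG)[y yg /phiI <-]. Qed.

(** Multiplication by b is not a map of degree 0, so this is not an instance of
    the preceding lemmas; the same comparison of components applies after
    shifting the degrees by d. *)
Lemma homogeneous_factor_piece (F : gradedModule K dg) d g (b : R) (x : F) :
  homogeneous dg d b -> injective (fun y : F => b *: y) ->
  gpiece (d + g) (b *: x) -> gpiece g x.
Proof.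
move=> bd b_inj bxg; have [s [f [us gs fp xE]]] := homogeneous_decomposition g x.
suff /b_inj <- : b *: f g = b *: x by [].
pose F0 e := b *: f (e - d) - (if e == d + g then b *: x else 0).
have us' : uniq [seq d + e | e <- s] by rewrite map_inj_uniq //; apply: addrI.
suff /eqP : F0 (d + g) = 0.
  by rewrite /F0 eqxx addrAC subrr add0r subr_eq0 => /eqP.
apply: (grading_direct (gpieceP F) us' (f := F0)); last exact: map_f.
  move=> e; rewrite /F0; apply: gradingD (gpieceP F) _ _ _ _ _.
    rewrite -{1}(subrK d e) [_ - d + d]addrC.
    exact: gradingZ (gpieceP F) _ _ _ _ bd (fp _).
  by apply: gpieceN; case: eqP => [->//|_]; exact: grading0 (gpieceP F) _.
rewrite big_map sumrB; apply/eqP; rewrite subr_eq0; apply/eqP.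
rewrite (bigD1_seq g) //= [in RHS](bigD1_seq g) //= eqxx [in RHS]big1 ?addr0; last first.
  by move=> e /negPf eg; rewrite (inj_eq (addrI d)) eg.
rewrite xE scaler_sumr (bigD1_seq g) //=; congr (_ + _).
  by rewrite addrAC subrr add0r.
by apply: eq_bigr => e _; rewrite addrAC subrr add0r.
Qed.

Lemma homogeneousX k d (b : R) :
  homogeneous dg d b -> homogeneous dg (d *+ k) (b ^+ k).
Proof.
move=> bd; elim: k => [|k IHk]; first by rewrite expr0 mulr0n; apply: homogeneousC.
by rewrite exprS mulrS; apply: homogeneousM.
Qed.
End GradedModules.

(** * The first local cohomology as a torsion quotient *)

Section FirstLocalCohomology.
Variables (K : fieldType) (r : nat) (G : zmodType) (dg : 'I_r -> G).
Local Notation R := {mpoly K[r]}.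
Variables (J : R -> Prop) (M L : gradedModule K dg) (i : {linear M -> L}).
Hypothesis iG : graded_hom i.

(** The elements of L_g whose class in L / M is J-power torsion. *)
Definition saturation (g : G) (f : L) : Prop :=
  gpiece g f /\ exists k, forall b, ideal_pow J k b -> exists x, i x = b *: f.

Variable b0 : R.
Hypotheses (Jb0 : J b0).
Variable delta : G.
Hypothesis b0_hom : homogeneous dg delta b0.
Hypotheses (b0_inj : injective (fun f : L => b0 *: f)).
Hypotheses (b0_surj : forall f : L, exists f', b0 *: f' = f).

Let b0X_inj k : injective (fun f : L => b0 ^+ k *: f).
Proof.
elim: k => [|k IHk] x y /=; first by rewrite expr0 !scale1r.
by rewrite exprSr -!scalerA => /IHk /b0_inj.
Qed.

Let b0X_surj k (f : L) : exists f', b0 ^+ k *: f' = f.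
Proof.
elim: k f => [|k IHk] f; first by exists f; rewrite expr0 scale1r.
have [f1 <-] := IHk f; have [f2 <-] := b0_surj f1.
by exists f2; rewrite exprSr scalerA.
Qed.

Variable E : injective_resolution M.
Variable h : {linear L -> res_obj E 0}.
Hypotheses (hG : graded_hom h) (hE : forall x, h (i x) = res_aug E x).

Let d0_aug x : res_d E 0 (res_aug E x) = 0.
Proof. by apply/res_exact0; exists x. Qed.

Let d1_d0 e : res_d E 1 (res_d E 0 e) = 0.
Proof. by apply/(res_exactS (i := 0)); exists e. Qed.

(** J^k sends f into M, where d0 \o h = d0 \o aug = 0: this is the snake map
    from the torsion of L / M to H^1_J(M), computed inside E. *)
Lemma saturation_cocycle g f : saturation g f ->
  (res_d E 0 (h f) : restr (res_obj E 1)) \in @lc_cocycle _ _ _ _ J _ E 1 g.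
Proof.
move=> [fg [k kf]]; apply/asboolP; split; last exact: d1_d0.
  by apply: res_d_hom; apply: hG.
exists k => b /kf[x xE].
by rewrite -!linearZ_LR -xE hE d0_aug.
Qed.

(** If d0 (h f) = d0 e with e torsion, then h f - e comes from some x in M, so
    that e = h (f - i x). A power of J then sends f - i x to an element of M
    whose image in E^0 vanishes, hence to 0; as b0 is a nonzerodivisor on L,
    this forces f = i x. *)
Lemma saturation_boundary g f : saturation g f ->
  @lc_coboundary _ _ _ _ J _ E 1 g (res_d E 0 (h f)) <-> exists x, i x = f.
Proof.
move=> [fg [k kf]]; split; last first.
  move=> [x xf]; exists 0; split; last by rewrite -xf hE d0_aug linear0.
    exact: grading0 (gpieceP _) _.
  exact: Gamma0.
move=> [e [eg [l el] de]].
have /res_exact0[x xE] : res_d E 0 (h f - e) = 0 by rewrite linearB de subrr.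
exists x; apply/eqP; rewrite -subr_eq0; apply/eqP.
pose m := maxn k l.
have b0m : ideal_pow J m (b0 ^+ m) by apply: ideal_pow_exp.
apply: (@b0X_inj m); rewrite scaler0 scalerBr.
have [y yE] := kf _ (ideal_pow_le (leq_maxl k l) b0m).
rewrite -yE -linearZ_LR -linearB.
suff -> : b0 ^+ m *: x - y = 0 by rewrite linear0.
apply: (@res_aug_inj _ _ _ _ _ E); rewrite linear0 linearB linearZ_LR xE.
rewrite scalerBr (el _ (ideal_pow_le (leq_maxr k l) b0m)) subr0.
by rewrite -linearZ_LR -yE hE subrr.
Qed.

(** A torsion cocycle z = d0 e with J^k z = 0 has J^k e in the image of M.
    Since b0 is invertible on L, dividing b0^k e by b0^k in L produces f, and
    injectivity of b0 shows that, for every b in J^k, b f and b e come from the same element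
    of M, so that e - h f is torsion. *)
Lemma saturation_surj g (z : res_obj E 1) :
  gpiece g z -> Gamma J z -> res_d E 1 z = 0 ->
  exists2 f, saturation g f &
    @lc_coboundary _ _ _ _ J _ E 1 g (z - res_d E 0 (h f)).
Proof.
move=> zg [k kz] /(res_exactS (i := 0))[e0 e0z].
have := zg; rewrite -e0z => /(graded_hom_preimage (@res_d_hom _ _ _ _ _ E 0))[e eg].
rewrite {}e0z => ez.
(* multiplying e by an element of J^k kills z = d0 e, hence lands in M *)
have lift b : ideal_pow J k b -> exists x, res_aug E x = b *: e.
  by move=> /kz bz; apply/res_exact0; rewrite linearZ_LR ez.
have b0k := ideal_pow_exp k Jb0.
have [x0 x0E] := lift _ b0k.
have [f fE] := b0X_surj k (i x0).
have bf b : ideal_pow J k b -> exists2 x, i x = b *: f & res_aug E x = b *: e.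
  move=> Jb; have [x xE] := lift _ Jb; exists x => //.
  apply: (@b0X_inj k); rewrite -linearZ_LR scalerA mulrC -scalerA fE -linearZ_LR.
  congr (i _); apply: (@res_aug_inj _ _ _ _ _ E); rewrite !linearZ_LR xE x0E.
  by rewrite !scalerA mulrC.
have tors : Gamma J (e - h f).
  exists k => b /bf[x xi xe]; rewrite scalerBr -linearZ_LR -xi hE xe subrr //.
have fg : gpiece g f.
  apply: (homogeneous_factor_piece (homogeneousX (k := k) b0_hom) (@b0X_inj k)).
  rewrite fE; apply: iG.
  apply: (graded_hom_inj_piece (@res_aug_hom _ _ _ _ _ E) (@res_aug_inj _ _ _ _ _ E)).
  rewrite x0E; apply: gradingZ (gpieceP _) _ _ _ _ _ eg; exact: homogeneousX.
exists f; first by split=> //; exists k => b /bf[x]; exists x.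
exists (e - h f); split=> //; last by rewrite linearB ez.
by apply: gradingD (gpieceP _) _ _ _ eg _; apply: gpieceN; exact: hG.
Qed.

End FirstLocalCohomology.

Section Complement.
Variables (K : fieldType) (r : nat) (G : zmodType) (dg : 'I_r -> G).
Local Notation R := {mpoly K[r]}.
Variables (J : R -> Prop) (M L : gradedModule K dg) (i : {linear M -> L}).

(** When some b0 in J acts bijectively on L, all H^i_J(L) vanish and the long
    exact sequence of 0 -> M -> L -> L / M -> 0 gives
    H^1_J(M)_g = Gamma_J(L / M)_g, the saturation modulo M_g. The quotient is
    presented here by a K-space V that j identifies with a complement of M_g, which is
    how a space with a monomial basis arises. *)
Theorem local_cohomology1_complement (b0 : R) (delta g : G) (V : lmodType K)
    (j : {linear V -> restr L}) (E : injective_resolution M) :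
    graded_hom i -> injective i ->
    J b0 -> homogeneous dg delta b0 ->
    injective (fun f : L => b0 *: f) -> (forall f : L, exists f', b0 *: f' = f) ->
    (forall v, saturation J i g (j v : L)) ->
    (forall f, saturation J i g f -> exists v x, f = (j v : L) + i x) ->
    (forall v x, (j v : L) = i x -> v = 0) ->
  exists psi : {linear local_cohomology J E 1 g -> V}, bijective psi.
Proof.
move=> iG i_inj Jb0 b0_hom b0_inj b0_surj j_sat j_span j_dir.
(* graded injectivity of E^0 extends the augmentation from M to L *)
have [h hG hE] := res_injective (i := 0) iG (res_aug_hom E) i_inj.
pose cocycle v : subm (@lc_cocycle _ _ _ _ J _ E 1 g) :=
  Sub (res_d E 0 (h (j v : L)) : restr _) (saturation_cocycle hG hE (j_sat v)).
have cocycle_lin : linear cocycle.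
  move=> a u v; apply: val_inj.
  change (res_d E 0 (h (j (a *: u + v) : L)) =
    (a%:MP : R) *: res_d E 0 (h (j u : L)) + res_d E 0 (h (j v : L))).
  have -> : (j (a *: u + v) : L) = (a%:MP : R) *: (j u : L) + (j v : L).
    by rewrite linearP.
  by rewrite !linearP.
pose pi := (\pi_(Quotient.quot (lpred (@lc_boundary _ _ _ _ J _ E 1 g))))%qT.
pose psi v : local_cohomology J E 1 g := pi (cocycle v).
have psi_lin : linear psi.
  by move=> a u v; rewrite /psi cocycle_lin; apply: lquot_pi_linear.
pose psiM := GRing.isLinear.Build K V (local_cohomology J E 1 g) *:%R psi psi_lin.
pose psiL : {linear V -> local_cohomology J E 1 g} := HB.pack psi psiM.
apply: (@linear_inverse _ _ _ psiL).
  apply: raddf_inj => v.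
  move=> /lquot_pi_eq0/asboolP vB.
  have /(saturation_boundary Jb0 b0_inj hE (j_sat v))[x xE] := vB.
  by apply: (j_dir v x).
elim/lquot_ind => z.
have /asboolP[zg zJ dz] := valP z.
have [f fS fB] := saturation_surj iG Jb0 b0_hom b0_inj b0_surj hG hE zg zJ dz.
have [v [x fE]] := j_span _ fS; exists v.
apply/eqP; rewrite -subr_eq0; apply/eqP; rewrite -[_ - _](raddfB pi).
apply/lquot_pi_eq0; rewrite -opprB rpredN; apply/asboolP.
have -> : (val (z - cocycle v) : res_obj E 1) = (val z : res_obj E 1) - res_d E 0 (h f).
  have -> : h f = h (j v : L) + res_aug E x by rewrite fE -hE -[RHS]linearD.
  have d0_aug : res_d E 0 (res_aug E x) = 0 by apply/res_exact0; exists x.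
  by rewrite [res_d E 0 (_ + _)]linearD d0_aug addr0.
exact: fB.
Qed.
End Complement.

(** * Laurent polynomials as a graded module *)

Section LaurentModule.
Variables (K : fieldType) (r : nat).
Local Notation R := {mpoly K[r]}.
Local Notation Zr := {ffun 'I_r -> int}.

Definition int_exponent (m : 'X_{1..r}) : Zr := [ffun i => (m i)%:Z].

Lemma int_exponentD m m' :
  int_exponent (m + m')%MM = int_exponent m + int_exponent m'.
Proof. by apply/ffunP => i; rewrite !ffunE mnmDE PoszD. Qed.

Lemma int_exponent0 : int_exponent 0%MM = 0.
Proof. by apply/ffunP => i; rewrite !ffunE mnm0E. Qed.

Lemma int_exponent_inj : injective int_exponent.
Proof.
by move=> m m' /ffunP e; apply/mnmP=> i; have := e i; rewrite !ffunE => -[].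
Qed.

(** Laurent polynomials, as finitely supported functions on exponent vectors.
    The alias keeps the module structure over the polynomial ring apart from
    the K-linear structure of {freeg Zr / K}. *)
Definition laurent_module : Type := {freeg Zr / K}.
HB.instance Definition _ := GRing.Zmodule.on laurent_module.
Local Notation L := laurent_module.

Lemma laurentP (f f' : L) : (forall w, coeff w f = coeff w f') -> f = f'.
Proof. by move=> e; apply/eqP/freeg_eqP. Qed.

Definition laurent_act (p : R) (f : L) : L :=
  \sum_(m <- msupp p) \sum_(w <- dom f)
    (<< p@_m * coeff w f *g int_exponent m + w >> : {freeg Zr / K}).

Lemma coeff_sum (I : Type) (s : seq I) (F : I -> L) u :
  coeff u (\sum_(x <- s) F x : L) = \sum_(x <- s) coeff u (F x).
Proof. exact: (raddf_sum (coeff u)). Qed.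

Lemma coeff_act p f u : coeff u (laurent_act p f) =
  \sum_(m <- msupp p) p@_m * coeff (u - int_exponent m) f.
Proof.
rewrite /laurent_act coeff_sum; apply: eq_bigr => m _; rewrite coeff_sum.
under eq_bigr => w _ do rewrite coeffU.
have E w : (int_exponent m + w == u) = (w == u - int_exponent m).
  by rewrite -[RHS]eq_sym subr_eq addrC eq_sym.
have [uf|uf] := boolP (u - int_exponent m \in dom f).
  rewrite (bigD1_seq _ uf (uniq_dom f)) /= E eqxx mulr1 big1 ?addr0 // => w.
  by rewrite E => /negPf->; rewrite mulr0.
rewrite (coeff_outdom uf) mulr0 big_seq big1 // => w wf.
rewrite E; case: eqP => [we|_]; last by rewrite mulr0.
by rewrite -we wf in uf.
Qed.

(** Summing over a list larger than the support makes the action visibly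
    additive in the polynomial. *)
Lemma coeff_act_widen (s : seq 'X_{1..r}) p f u :
  uniq s -> {subset msupp p <= s} ->
  coeff u (laurent_act p f) = \sum_(m <- s) p@_m * coeff (u - int_exponent m) f.
Proof.
move=> us ps; rewrite coeff_act [RHS](bigID (mem (msupp p))) /=.
rewrite [X in _ = _ + X]big1 ?addr0; last first.
  by move=> m /memN_msupp_eq0->; rewrite mul0r.
rewrite -[in RHS]big_filter; apply: perm_big; apply: uniq_perm.
- exact: msupp_uniq.
- exact: filter_uniq.
by move=> m; rewrite mem_filter; case: (boolP (m \in msupp p)) => // /ps->.
Qed.

Lemma laurent_actDl f : {morph laurent_act^~ f : p q / p + q}.
Proof.
move=> p q; apply: laurentP => u.
pose s := undup (msupp p ++ msupp q).
have us : uniq s by apply: undup_uniq.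
rewrite coeffD !(coeff_act_widen (s := s)) // => [|m|m|m].
- by rewrite -big_split; apply: eq_bigr => m _; rewrite mcoeffD mulrDl.
- by rewrite mem_undup mem_cat => ->; rewrite orbT.
- by rewrite mem_undup mem_cat => ->.
by rewrite mem_undup; apply: msuppD_le.
Qed.

Lemma laurent_actDr : right_distributive laurent_act +%R.
Proof.
move=> p f f'; apply: laurentP => u; rewrite coeffD !coeff_act -big_split.
by apply: eq_bigr => m _; rewrite coeffD mulrDr.
Qed.

Lemma coeff_actX c m f u :
  coeff u (laurent_act (c *: 'X_[m]) f) = c * coeff (u - int_exponent m) f.
Proof.
rewrite (coeff_act_widen (s := [:: m])) //; last first.
  by move=> m' /msuppZ_le; rewrite msuppX.
by rewrite big_seq1 mcoeffZ mcoeffX eqxx mulr1.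
Qed.

Lemma laurent_act0 f : laurent_act 0 f = 0.
Proof. by apply: laurentP => u; rewrite coeff_act msupp0 big_nil coeff0. Qed.

Lemma laurent_act_suml (I : Type) (s : seq I) (F : I -> R) f :
  laurent_act (\sum_(x <- s) F x) f = \sum_(x <- s) laurent_act (F x) f.
Proof. exact: (big_morph (laurent_act^~ f) (laurent_actDl f) (laurent_act0 f)). Qed.

Lemma laurent_act_sumr (I : Type) (s : seq I) (F : I -> L) p :
  laurent_act p (\sum_(x <- s) F x) = \sum_(x <- s) laurent_act p (F x).
Proof.
apply: (big_morph (laurent_act p) (laurent_actDr p)).
by apply: laurentP => u; rewrite coeff_act coeff0 big1 // => m _; rewrite coeff0 mulr0.
Qed.

Lemma laurent_actA p q f : laurent_act p (laurent_act q f) = laurent_act (p * q) f.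
Proof.
rewrite (mpolyE p) (mpolyE q) mulr_suml !laurent_act_suml; apply: eq_bigr => m _.
rewrite mulr_sumr laurent_act_sumr laurent_act_suml; apply: eq_bigr => m' _.
apply: laurentP => u.
rewrite -scalerAl -scalerAr -mpolyXD scalerA !coeff_actX.
by rewrite int_exponentD opprD addrA mulrA.
Qed.

Lemma laurent_actC c f : laurent_act c%:MP f = c *: (f : {freeg Zr / K}).
Proof.
apply: laurentP => u; rewrite coeffZ -[c%:MP]mulr1 mul_mpolyC -mpolyX0 coeff_actX.
by rewrite int_exponent0 subr0.
Qed.

Lemma laurent_act1 : left_id 1 laurent_act.
Proof. by move=> f; rewrite -mpolyC1 laurent_actC scale1r. Qed.

HB.instance Definition _ := GRing.Zmodule_isLmodule.Build R L
  laurent_actA laurent_act1 laurent_actDr laurent_actDl.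

Lemma laurent_scaleE (p : R) (f : L) : p *: f = laurent_act p f.
Proof. by []. Qed.

Lemma coeff_scaleX m (f : L) u :
  coeff u ('X_[m] *: f : L) = coeff (u - int_exponent m) f.
Proof. by rewrite laurent_scaleE -['X_[m]]scale1r coeff_actX mul1r. Qed.

Lemma scaleX_inj m : injective (fun f : L => ('X_[m] : R) *: f).
Proof.
move=> f f' e; apply: laurentP => u.
by have := congr1 (coeff (u + int_exponent m)) e; rewrite !coeff_scaleX addrK.
Qed.

(** With [scaleX_inj]: monomials act invertibly, the property for which
    Laurent polynomials are used. *)
Lemma scaleX_surj m (f : L) : exists f' : L, ('X_[m] : R) *: f' = f.
Proof.
exists (\sum_(w <- dom f) (<< coeff w f *g w - int_exponent m >> : {freeg Zr / K})).
apply: laurentP => u; rewrite coeff_scaleX coeff_sum.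
rewrite -[in RHS](freeg_sumE f) [in RHS]coeff_sum; apply: eq_bigr => w _.
by rewrite !coeffU (inj_eq (addIr _)).
Qed.

Definition laurent_filter (p : pred Zr) (f : L) : L :=
  \sum_(w <- dom f) (<< coeff w f *+ p w *g w >> : {freeg Zr / K}).

Lemma coeff_filter p f u : coeff u (laurent_filter p f) = coeff u f *+ p u.
Proof.
rewrite coeff_sum; under eq_bigr do rewrite coeffU.
have [uf|uf] := boolP (u \in dom f).
  rewrite (bigD1_seq _ uf (uniq_dom f)) /= eqxx mulr1 big1 ?addr0 // => w.
  by move=> /negPf->; rewrite mulr0.
rewrite (coeff_outdom uf) mul0rn big_seq big1 // => w wf.
by case: (w =P u) => [we|_]; rewrite ?mulr0 // -we wf in uf *.
Qed.

Section Grading.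
Variables (G : zmodType) (dg : 'I_r -> G).

Definition laurent_degree (w : Zr) : G := \sum_i dg i *~ w i.

Lemma laurent_degreeD w w' :
  laurent_degree (w + w') = laurent_degree w + laurent_degree w'.
Proof. by rewrite -big_split; apply: eq_bigr => i _; rewrite ffunE mulrzDr. Qed.

Lemma laurent_degree_exponent m : laurent_degree (int_exponent m) = mon_degree dg m.
Proof. by apply: eq_bigr => i _; rewrite ffunE -pmulrn. Qed.

Definition laurent_piece (g : G) (f : L) : Prop :=
  forall w, coeff w f != 0 -> laurent_degree w = g.

Lemma coeff_act_neq0 p f u : coeff u (laurent_act p f) != 0 ->
  exists2 m, m \in msupp p & coeff (u - int_exponent m) f != 0.
Proof.
move=> ne; have [/hasP[m mp ne_m]|/hasPn all0] :=
  boolP (has (fun m => coeff (u - int_exponent m) f != 0) (msupp p)).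
  by exists m.
move: ne; rewrite coeff_act big_seq big1 ?eqxx // => m /all0/negPn/eqP->.
by rewrite mulr0.
Qed.

Fact laurent_grading : is_grading dg laurent_piece.
Proof.
split.
- by move=> g w; rewrite coeff0 eqxx.
- move=> g f f' fg f'g w; rewrite coeffD => ne.
  have [f0|/fg//] := eqVneq (coeff w f) 0.
  by apply: f'g; rewrite f0 add0r in ne.
- move=> g h a f ag fh w /coeff_act_neq0[m /ag <- /fh <-].
  by rewrite -laurent_degree_exponent -laurent_degreeD addrC subrK.
- move=> f; exists (undup [seq laurent_degree w | w <- dom f]).
  pose part g := laurent_filter (fun w => laurent_degree w == g) f.
  exists part.
    by move=> g w; rewrite coeff_filter; case: (_ =P g) => // _; rewrite eqxx.
  apply: laurentP => u; rewrite coeff_sum.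
  under eq_bigr do rewrite coeff_filter.
  have [uf|uf] := boolP (u \in dom f); last first.
    by rewrite (coeff_outdom uf) big1 // => g _; rewrite mul0rn.
  have ud : laurent_degree u \in undup [seq laurent_degree w | w <- dom f].
    by rewrite mem_undup map_f.
  rewrite (bigD1_seq _ ud (undup_uniq _)) /= eqxx mulr1n big1 ?addr0 // => g.
  by rewrite eq_sym => /negPf->.
- move=> s f us fp f0 g gs; apply: laurentP => u; rewrite coeff0.
  apply/eqP; apply: contraTT isT => ne.
  have := congr1 (coeff u) f0; rewrite coeff_sum (bigD1_seq g) //= big1 ?addr0.
    by rewrite coeff0 => u0; rewrite u0 eqxx in ne.
  move=> h hg; apply/eqP; apply: contraNT hg => ne'.
  by rewrite -(fp _ _ ne) -(fp _ _ ne').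
Qed.

Definition laurent_gmod : gradedModule K dg := GradedModule laurent_grading.
End Grading.

Section Monomial.
Variable gens : seq 'X_{1..r}.
Let S (f : R) := exists2 g, g \in gens & f = 'X_[g].

Definition laurent_one : L := (<< 0 >> : {freeg Zr / K}).

Definition laurent_incl (x : ideal_mod S) : L := (val x : R) *: laurent_one.

Lemma laurent_incl_linear : linear laurent_incl.
Proof. by move=> a x y; rewrite /laurent_incl linearP scalerDl scalerA. Qed.
HB.instance Definition _ :=
  GRing.isLinear.Build R (ideal_mod S) L *:%R laurent_incl laurent_incl_linear.

Lemma coeff_incl x m : coeff (int_exponent m) (laurent_incl x) = (val x : R)@_m.
Proof.
rewrite coeff_act; under eq_bigr => m' _
  do rewrite coeffU mul1r eq_sym subr_eq0 (inj_eq int_exponent_inj).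
have [mx|mx] := boolP (m \in msupp (val x : R)).
  rewrite (bigD1_seq _ mx (msupp_uniq _)) /= eqxx mulr1 big1 ?addr0 // => m'.
  by rewrite eq_sym => /negPf->; rewrite mulr0.
rewrite (memN_msupp_eq0 mx) big_seq big1 // => m' m'x.
by case: eqP => [e|_]; rewrite ?mulr0 // e m'x in mx *.
Qed.

Lemma laurent_incl_inj : injective laurent_incl.
Proof.
by move=> x y e; apply: val_inj; apply/mpolyP => m; rewrite -!coeff_incl e.
Qed.

(** A monomial ideal is spanned by the monomials divisible by a generator; the
    condition also rules out negative exponents. *)
Lemma laurent_incl_im (f : L) : (exists x, laurent_incl x = f) <->
  (forall w, coeff w f != 0 -> exists2 g, g \in gens & forall i, (g i)%:Z <= w i).
Proof.
split.
  move=> [x <-] w.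
  have /asboolP[l lS xE] := valP x.
  rewrite /laurent_incl xE /= scaler_suml coeff_sum => ne.
  have [p pl] : exists2 p, p \in l & coeff w ((p.1 * p.2) *: laurent_one : L) != 0.
    have [/hasP[p pl ne_p]|/hasPn all0] :=
      boolP (has (fun p => coeff w ((p.1 * p.2) *: laurent_one : L) != 0) l).
      by exists p.
    by move: ne; rewrite big_seq big1 ?eqxx // => p /all0/negPn/eqP.
  have [g gg ->] := lS _ pl.
  move=> /coeff_act_neq0[m mp]; rewrite coeffU mul1r.
  case: (0 =P w - int_exponent m) => [|_]; last by rewrite eqxx.
  move=> /esym/eqP; rewrite subr_eq0 => /eqP -> _; exists g => // i.
  move: mp => /msuppM_le /allpairsP[[m1 m2] /= [_]].
  rewrite msuppX inE => /eqP -> ->.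
  by rewrite ffunE lez_nat mnmDE leq_addl.
move=> fS.
have mono w : coeff w f != 0 ->
    exists x, laurent_incl x = (<< coeff w f *g w >> : {freeg Zr / K}).
  move=> /fS[g gg gw].
  pose m : 'X_{1..r} := [multinom `|w i|%N | i < r].
  have gm : (g <= m)%MM.
    by apply/mnm_lepP => i; rewrite mnmE -lez_nat (le_trans (gw i)) // lez_abs.
  have mw : int_exponent m = w.
    by apply/ffunP => i; rewrite ffunE mnmE gez0_abs // (le_trans _ (gw i)).
  have xS : ((coeff w f)%:MP * ('X_[m - g] * 'X_[g]) : R^o) \in ideal_pred S.
    apply/asboolP; apply: ideal_genM; apply: ideal_genM; apply: ideal_gen_mem.
    by exists g.
  exists (@Sub _ _ (subm (ideal_pred S)) _ xS).
  rewrite /laurent_incl SubK -mpolyXD submK //.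
  apply: laurentP => u.
  rewrite laurent_scaleE mul_mpolyC coeff_actX !coeffU mul1r eq_sym subr_eq0 mw.
  by rewrite eq_sym.
rewrite -(freeg_sumE f) big_seq.
elim/big_ind: _ => [|_ _ [x <-] [y <-]|w]; first by exists 0; rewrite linear0.
  by exists (x + y); rewrite linearD.
by rewrite mem_dom => /mono.
Qed.

End Monomial.
End LaurentModule.

(** * Klyachko diagrams *)

Section KlyachkoDiagram.
Variables (R : realType) (n r : nat) (X : smoothCompleteFan R n r).
Variable gens : seq 'X_{1..r}.

Lemma min_exp_le (g : 'X_{1..r}) i : g \in gens -> (min_exp gens i <= g i)%N.
Proof.
rewrite /min_exp; move: (X in \big[_/X]_(_ <- _) _) => x0.
elim: gens => //= g0 s IHs; rewrite inE big_cons => /orP[/eqP->|/IHs].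
  exact: geq_minl.
exact: leq_trans (geq_minr _ _).
Qed.

(** In a list sorted by f, the entries with f x <= a form a prefix; k is its
    length. *)
Lemma sorted_threshold (T : eqType) (x0 : T) (f : T -> nat) (s : seq T) (a : int) :
  sorted (fun x y => (f x <= f y)%N) s ->
  exists2 k, (k <= size s)%N &
    (forall j, (j < size s)%N -> ((f (nth x0 s j))%:Z <= a) = (j < k)%N)
    /\ (forall x, (x \in take k s) = (x \in s) && ((f x)%:Z <= a)).
Proof.
move=> s_sorted; pose k := find (fun x => a < (f x)%:Z) s.
have kE j : (j < size s)%N -> ((f (nth x0 s j))%:Z <= a) = (j < k)%N.
  move=> js; have [jk|kj] := ltnP j k; first by rewrite leNgt (before_find x0 jk).
  apply/negbTE; rewrite -ltNge.
  have ks : (k < size s)%N by apply: leq_ltn_trans js.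
  have hk : has (fun x => a < (f x)%:Z) s by rewrite has_find.
  apply: lt_le_trans (nth_find x0 hk) _; rewrite lez_nat.
  by apply: (sorted_leq_nth _ _ x0 s_sorted) => // x y z; apply: leq_trans.
exists k; [exact: find_size|split=> // x].
have [xs|xs] := boolP (x \in s); last by apply: contraNF xs => /mem_take.
by rewrite in_take // -kE ?index_mem // nth_index.
Qed.

(** The slabs that cut out Delta along the last ray i are disjoint: m lies in
    the one whose index k is the number of generators g in S with
    g i <= pairing m i, and membership in Delta passes to the remaining rays
    with exactly these k generators, those that m dominates along i. By
    induction m is in C but outside Delta exactly when some generator survives
    all rays. *)
Lemma Cset_minus_Delta_seq l (S : seq 'X_{1..r}) m : {subset S <= gens} ->
  Cset_seq X gens l m && ~~ Delta_seq X gens l S m =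
    has (fun g : 'X_{1..r} => all (fun i => (g i)%:Z <= pairing X m i) l) S.
Proof.
elim: l S => [|i l IHl] [|g0 S0] Sg; rewrite ?andbN //.
move: Sg; set S := g0 :: S0 => Sg.
set leS := fun a b : 'X_{1..r} => (a i <= b i)%N.
set a := pairing X m i.
have S'_sorted : sorted leS (sort leS S).
  by apply: sort_sorted => x y; apply: leq_total.
have [k kS [kE kmem]] :=
  sorted_threshold 0%MM (f := fun g : 'X_{1..r} => g i) a S'_sorted.
rewrite size_sort in kS kE.
have S_gt0 : (0 < size S)%N by [].
have takeE :
    has (fun g : 'X_{1..r} => all (fun i => (g i)%:Z <= pairing X m i) (i :: l)) S =
    has (fun g : 'X_{1..r} => all (fun i => (g i)%:Z <= pairing X m i) l)
      (take k (sort leS S)).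
  apply/hasP/hasP => -[g gS] /=.
    by case/andP => gi gl; exists g; rewrite // kmem mem_sort gS.
  by move: gS; rewrite kmem mem_sort => /andP[gS gi] gl; exists g; rewrite //= gi.
have take_gens : {subset take k (sort leS S) <= gens}.
  by move=> g; rewrite kmem mem_sort => /andP[/Sg].
have DeltaE : (min_exp gens i)%:Z <= a ->
    Delta_seq X gens (i :: l) S m = Delta_seq X gens l (take k (sort leS S)) m.
  move=> mina; rewrite /= -/leS -/a mina /=.
  have dE j : (j < size S)%N ->
      (a < ((nth 0%MM (sort leS S) j : 'X_{1..r}) i)%:Z) = (k <= j)%N.
    by move=> jS; rewrite ltNge kE // -leqNgt.
  have last_lt : ((size S).-1 < size S)%N by rewrite prednK.
  (* on a single ray only the slab below all generators belongs to Delta *)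
  case: l {IHl takeE} => [|i' l'].
    rewrite dE // leqn0; case: (posnP k) => [->|k_gt0]; first by rewrite take0.
    have : (0 < size (take k (sort leS S)))%N by rewrite size_take size_sort; case: ifP.
    by case: (take k _).
  move: (i' :: l') => {i' l'} l; rewrite dE // leqn0 kE //.
  rewrite -[(size S0 < k)%N]/(size S <= k)%N.
  have [k0|k_gt0] := posnP k.
    rewrite k0 take0 /= orbF.
    case: (Delta_seq X gens l [::] m) => //=; apply/existsP => -[j].
    by case/and3P=> j_gt0; rewrite kE ?k0 // (leq_ltn_trans (leq_pred _)).
  move: kS; rewrite leq_eqVlt => /orP[/eqP kS|kS].
    rewrite kS leqnn /= [take _ _]take_oversize ?size_sort //.
    case: (Delta_seq X gens l (sort leS S) m); first by rewrite orbT.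
    rewrite orbF; apply/existsP => -[j] /and3P[_ /andP[_]].
    by rewrite dE // kS leqNgt ltn_ord.
  rewrite [(size S <= k)%N]leqNgt kS /= orbF.
  apply/existsP/idP => [[j]|Dk]; last first.
    exists (Ordinal kS); rewrite /= k_gt0 Dk andbT kE ?dE //; last first.
      by rewrite (leq_ltn_trans (leq_pred _)).
    by rewrite leqnn prednK ?leqnn.
  case/and3P=> j_gt0; rewrite kE; last exact: leq_ltn_trans (leq_pred _) (ltn_ord j).
  rewrite dE // prednK //.
  by rewrite -eqn_leq => /eqP ->.
rewrite takeE -IHl // [Cset_seq X gens (i :: l) m]/= -/a.
have [mina|mina] := boolP ((min_exp gens i)%:Z <= a); first by rewrite DeltaE.
rewrite /=; suff -> : take k (sort leS S) = [::] by rewrite IHl.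
apply/eqP; rewrite -size_eq0 -leqn0 leqNgt; apply: contra mina => size_gt0.
have := mem_nth 0%MM size_gt0; rewrite kmem mem_sort => /andP[/Sg/(min_exp_le i)].
by rewrite -lez_nat => /le_trans; apply.
Qed.

Lemma Cset_minus_Delta s m :
  (Cset X gens s m /\ ~ Delta X gens s m) <->
  exists2 g : 'X_{1..r}, g \in gens & forall i, i \in s -> (g i)%:Z <= pairing X m i.
Proof.
have -> : (Cset X gens s m /\ ~ Delta X gens s m) <->
    Cset X gens s m && ~~ Delta X gens s m.
  by split=> [[-> /negP]|/andP[-> /negP]].
rewrite /Cset /Delta Cset_minus_Delta_seq //; split=> [/hasP[g gg /allP gs]|[g gg gs]].
  by exists g => // i si; apply: gs; rewrite mem_rev mem_enum.
by apply/hasP; exists g => //; apply/allP => i; rewrite mem_rev mem_enum => /gs.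
Qed.

End KlyachkoDiagram.

(** * Saturation of a monomial ideal *)

Section MonomialSaturation.
Variables (K : fieldType) (r : nat).
Local Notation R := {mpoly K[r]}.
Local Notation Zr := {ffun 'I_r -> int}.
Variable C : {set {set 'I_r}}.

Definition complement_exponent (s : {set 'I_r}) : 'X_{1..r} :=
  [multinom (i \notin s : nat) | i < r].

Lemma complement_monomial (s : {set 'I_r}) :
  \prod_(i | i \notin s) 'X_i = 'X_[complement_exponent s] :> R.
Proof.
rewrite mpolyXE_id big_mkcond; apply: eq_bigr => i _.
by rewrite mnmE; case: (i \notin s).
Qed.

Let J : R -> Prop :=
  ideal_gen (fun f => exists2 s, s \in C & f = \prod_(i | i \notin s) 'X_i).

Lemma complement_monomial_mem s : s \in C -> J 'X_[complement_exponent s].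
Proof.
by move=> sC; apply: ideal_gen_mem; exists s; rewrite ?complement_monomial.
Qed.

(** x^m is divisible by a product of k of the monomials attached to the cones
    of C, the cone s being used e s times. *)
Definition cone_weights (k : nat) (m : 'X_{1..r}) : Prop :=
  exists2 e : {set 'I_r} -> nat, (\sum_(s in C) e s = k)%N
    & forall i, (\sum_(s in C | i \notin s) e s <= m i)%N.

Lemma cone_weightsD k l m m' : cone_weights k m -> cone_weights l m' ->
  cone_weights (k + l) (m + m')%MM.
Proof.
move=> [e ek em] [e' ek' em']; exists (fun s => e s + e' s)%N.
  by rewrite big_split ek ek'.
by move=> i; rewrite big_split mnmDE leq_add.
Qed.

Lemma cone_weights0 m : cone_weights 0 m.
Proof. by exists (fun=> 0%N) => [|i]; rewrite big1. Qed.

Lemma msupp_sum_mem (T : eqType) (l : seq T) (F : T -> R) m :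
  m \in msupp (\sum_(p <- l) F p) -> exists2 p, p \in l & m \in msupp (F p).
Proof.
move=> /msupp_sum_le/flattenP[ms /mapP[p]]; rewrite filter_predT => pl -> mp.
by exists p.
Qed.

Lemma irrelevant_support f m : J f -> m \in msupp f -> cone_weights 1 m.
Proof.
move=> [l lS ->] /msupp_sum_mem[p /lS[s sC ->]].
rewrite complement_monomial => /msuppM_le/allpairsP[[m1 m2] /= [_]].
rewrite msuppX inE => /eqP -> ->; apply: (@cone_weightsD 0 1).
  exact: cone_weights0.
exists (fun s' => nat_of_bool (s' == s)).
  by rewrite (bigD1 s) //= eqxx big1 // => s' /andP[_ /negPf->].
move=> i; rewrite mnmE; have [si|si] := boolP (i \in s).
  by rewrite big1 // => s' /andP[_]; case: eqP => // ->; rewrite si.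
rewrite (bigD1 s) ?sC //= eqxx big1 // => s' /andP[_ /negPf->] //.
Qed.

Lemma irrelevant_pow_support k f m :
  ideal_pow J k f -> m \in msupp f -> cone_weights k m.
Proof.
move=> [l lS ->] /msupp_sum_mem[p /lS[b Jb ->]].
move=> /msuppM_le/allpairsP[[m1 m2] /= [_ m2b ->]].
apply: (@cone_weightsD 0); first exact: cone_weights0.
elim: k b Jb m2 m2b {m1 p lS} => [|k IHk] b Jb m2.
  by move=> _; apply: cone_weights0.
rewrite big_ord_recl => /msuppM_le/allpairsP[[m3 m4] /= [m3b m4b ->]].
apply: (@cone_weightsD 1); first exact: irrelevant_support m3b.
by apply: IHk m4b => i; apply: Jb.
Qed.

Lemma cone_weights_pigeonhole N k m : (N * #|C| < k)%N -> cone_weights k m ->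
  exists2 s, s \in C & forall i, i \notin s -> (N <= m i)%N.
Proof.
move=> Nk [e ek em].
have [/existsP[s /andP[sC Ns]]|/existsPn small] :=
  boolP [exists s, (s \in C) && (N <= e s)%N].
  exists s => // i si; apply: leq_trans Ns (leq_trans _ (em i)).
  by rewrite (bigD1 s) ?sC //= leq_addr.
move: Nk; rewrite -ek ltnNge mulnC -sum_nat_const leq_sum // => s sC.
by have := small s; rewrite sC -ltnNge => /ltnW.
Qed.

Variables (G : zmodType) (dg : 'I_r -> G).
Variable gens : seq 'X_{1..r}.
Local Notation S := (fun f : R => exists2 g, g \in gens & f = 'X_[g]).
Variable homS : forall f, S f -> exists g, homogeneous dg g f.
Local Notation I := (homogeneous_ideal homS).
Local Notation L := (laurent_gmod K dg).
Local Notation incl := (@laurent_incl K r gens : {linear I -> L}).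

Lemma laurent_incl_graded : graded_hom incl.
Proof.
move=> g x xg w /coeff_act_neq0[m /xg <-]; rewrite coeffU mul1r.
case: (0 =P w - int_exponent m) => [/esym/eqP|_]; last by rewrite eqxx.
by rewrite subr_eq0 => /eqP-> _; apply: laurent_degree_exponent.
Qed.

(** How far the exponents of f may fall short of those of the generators. *)
Lemma exponent_bound (f : laurent_module K r) : exists N : nat,
  forall g w i, g \in gens -> coeff w f != 0 -> ((g : 'X_{1..r}) i)%:Z <= w i + N%:Z.
Proof.
pose N1 := \max_(g <- gens) \max_(i < r) (g : 'X_{1..r}) i.
pose N2 := \max_(w <- dom f) \max_(i < r) `|(w : Zr) i|%N.
exists (N1 + N2)%N => g w i gg wf.
have gN : (g i <= N1)%N.
  by apply: bigmaxn_sup_seq gg isT _; apply: (leq_bigmax i).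
have wN : (`|w i| <= N2)%N.
  by rewrite -mem_dom in wf; apply: bigmaxn_sup_seq wf isT _; apply: (leq_bigmax i).
by rewrite -!lez_nat in gN wN; lia.
Qed.

(** A Laurent monomial x^w is carried into the ideal by a power of J exactly
    when, for each cone s, some generator a is dominated by w along the rays of
    s: high powers of the monomial of s make the other exponents irrelevant.
    Conversely a long product of such monomials contains, by pigeonhole, a high
    power of one of them, and the exponents of the generators and of the
    support of f are bounded. *)
Theorem monomial_saturation g f : saturation J incl g f <->
  laurent_piece dg g f /\
  forall w, coeff w f != 0 -> forall s, s \in C ->
    exists2 a, a \in gens & forall i, i \in s -> ((a : 'X_{1..r}) i)%:Z <= w i.
Proof.
split=> [[fg [k kf]]|[fg fC]]; split=> //.
  move=> w wf s sC.
  have /kf/laurent_incl_im im := ideal_pow_exp k (complement_monomial_mem sC).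
  have [|a aa aw] := im (w + int_exponent (complement_exponent s *+ k)%MM).
    by rewrite mpolyXn coeff_scaleX addrK.
  exists a => // i si; have := aw i.
  by rewrite !ffunE mulmnE mnmE si mul0n addr0.
have [N fN] := exponent_bound f.
exists (N * #|C|).+1 => b Jb; apply/laurent_incl_im => u.
move=> /coeff_act_neq0[m /(irrelevant_pow_support Jb) mb wf].
have [s sC sN] := cone_weights_pigeonhole (leqnn _) mb.
have [a aa aw] := fC _ wf s sC; exists a => // i.
have [si|si] := boolP (i \in s).
  by apply: le_trans (aw i si) _; rewrite !ffunE lerBlDr lerDl.
apply: le_trans (fN a _ i aa wf) _; rewrite !ffunE -addrA gerDl.
by rewrite addrC subr_le0 lez_nat; apply: sN.
Qed.

End MonomialSaturation.

(** * Laurent monomials on a toric variety *)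

Section ToricDegrees.
Variables (R : realType) (n r : nat) (X : smoothCompleteFan R n r).
Local Notation Zr := {ffun 'I_r -> int}.

Lemma laurent_degree_div_class (w : Zr) :
  laurent_degree (var_degree X) w = div_class X w.
Proof.
have wE : w = \sum_i [ffun j => (j == i)%:Z] *~ w i.
  apply/ffunP => j; rewrite sum_ffunE (bigD1 j) //= ffunMzE ffunE eqxx.
  rewrite big1 ?addr0 ?intz // => i; rewrite eq_sym => /negPf ij.
  by rewrite ffunMzE ffunE ij mul0rz.
rewrite /div_class [in RHS]wE raddf_sum; apply: eq_bigr => i _.
by rewrite raddfMz.
Qed.

(** The Laurent monomials of degree [D] are thus the x^(m+D). *)
Lemma div_class_eqP (w D : Zr) :
  div_class X w = div_class X D <-> exists m, w = laurent X m D.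
Proof.
have E := Quotient.idealrBE (principal X) w D.
split=> [e|[m wE]].
  have : w - D \in principal X by rewrite E; apply/eqP.
  move=> /asboolP[m wD]; exists m; apply/ffunP => i.
  by rewrite -[w](subrK D) wD !ffunE.
apply/eqP; rewrite -E; apply/asboolP; exists m; rewrite wE.
by apply/ffunP => i; rewrite !ffunE addrK.
Qed.

Lemma pairing_shift (D : {ffun 'I_r -> int}) (tau m' : 'cV[int]_n) i :
  pairing X tau i = D i -> pairing X (m' + tau) i = laurent X m' D i.
Proof. by move=> tauD; rewrite /pairing mulmxDr mxE ffunE -tauD. Qed.

Lemma cone_sub_max (s : {set 'I_r}) : s \in cones X ->
  exists2 s', s' \in max_cones X & s \subset s'.
Proof.
move=> sC; have [s' s'max ss'] := maxset_exists (P := mem (cones X)) sC.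
by exists s' => //; rewrite inE s'max andbT; case/maxsetP: s'max.
Qed.

Lemma cone_exists : exists s, s \in cones X.
Proof. by have [s sC _] := complete_fan X 0; exists s. Qed.

Lemma generatorsP t (m : 'I_t -> 'cV[int]_n) (k : 'I_t -> {ffun 'I_r -> int})
    (D w : {ffun 'I_r -> int}) m' :
  (forall i j, 0 <= pairing X (m i) j + k i j) -> w = laurent X m' D ->
  (exists i, Tset X D (m i) (k i) w) <->
  exists2 a, a \in generators X m k & forall j, ((a : 'X_{1..r}) j)%:Z <= w j.
Proof.
move=> mk_ge0 wE.
have expE i j : ((cox_monomial X (m i) (k i) j)%:Z = pairing X (m i) j + k i j).
  by rewrite mnmE ffunE gez0_abs.
split=> [[i [m'' -> le_m]]|[a /codomP[i ->] aw]].
  exists (cox_monomial X (m i) (k i)); first exact: codom_f.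
  by move=> j; rewrite expE ffunE -lerBlDr.
exists i, m' => // j.
by rewrite lerBlDr -expE; have := aw j; rewrite wE ffunE.
Qed.

End ToricDegrees.

(** * The first local cohomology of a monomial ideal *)

Theorem proposition3p15 (R : realType) (n r : nat) (X : smoothCompleteFan R n r)
    (t : nat) (t_gt0 : (0 < t)%N)
    (m : 'I_t -> 'cV[int]_n) (k : 'I_t -> {ffun 'I_r -> int})
    (mk_ge0 : forall i j, 0 <= pairing X (m i) j + k i j)
    (E : injective_resolution (monomial_ideal X (generators X m k)))
    (D : {ffun 'I_r -> int})
    (tau : {set 'I_r} -> 'cV[int]_n)
    (tauP : forall s j, s \in cones X -> j \in s -> pairing X (tau s) j = D j) :
  exists phi : {linear local_cohomology (irrelevant_ideal X) E 1 (div_class X D) ->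
      free_space R[i] (fun w : {ffun 'I_r -> int} =>
        (exists2 m' : 'cV[int]_n, w = laurent X m' D
           & forall s, s \in max_cones X ->
               Cset_shift X (generators X m k) (tau s) s m'
               /\ ~ Delta_shift X (generators X m k) (tau s) s m')
        /\ ~ (exists i : 'I_t, Tset X D (m i) (k i) w))},
    bijective phi.
Proof.
set gens := generators X m k.
set P := fun w : {ffun 'I_r -> int} => _ /\ _.
have max_in s : s \in max_cones X -> s \in cones X by rewrite inE => /andP[].
(* the shift by tau s turns pairings along s into exponents of x^(m'+D) *)
have coneP s m' : s \in cones X ->
    (Cset_shift X gens (tau s) s m' /\ ~ Delta_shift X gens (tau s) s m') <->
    exists2 a, a \in gens &
      forall i, i \in s -> ((a : 'X_{1..r}) i)%:Z <= laurent X m' D i.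
  move=> sC; rewrite /Cset_shift /Delta_shift.
  apply: (iff_trans (Cset_minus_Delta X gens s _)).
  by split=> -[a aa al]; exists a => // i si; have := al i si;
    rewrite (pairing_shift _ (tauP s i sC si)).
have degP w : laurent_degree (var_degree X) w = div_class X D <->
    exists m', w = laurent X m' D.
  by rewrite laurent_degree_div_class; apply: div_class_eqP.
have [s0 s0C] := cone_exists X.
pose incl : {linear monomial_ideal X gens -> laurent_gmod R[i] (var_degree X)} :=
  @laurent_incl R[i] r gens.
pose j (v : free_space R[i] P) : restr (laurent_gmod R[i] (var_degree X)) := val v.
have j_lin : linear j.
  by move=> a u v; rewrite /j linearP; congr (_ + _); rewrite -laurent_actC.
pose jM := GRing.isLinear.Build _ _ _ _ j j_lin.
pose jL : {linear free_space R[i] P -> restr (laurent_gmod R[i] (var_degree X))} :=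
  HB.pack j jM.
have vP (v : free_space R[i] P) w : coeff w (j v) != 0 -> P w.
  by have /asboolP := valP v; apply.
have satP := monomial_saturation (cones X) (@monomial_gens_homogeneous R n r X gens).
(* b0 can be the monomial of any cone, and a complete fan has one *)
apply: (local_cohomology1_complement (i := incl) (j := jL)
  (b0 := 'X_[complement_exponent s0])
  (delta := mon_degree (var_degree X) (complement_exponent s0))).
- exact: laurent_incl_graded.
- exact: laurent_incl_inj.
- exact: complement_monomial_mem.
- by move=> a; rewrite msuppX inE => /eqP->.
- exact: scaleX_inj.
- exact: scaleX_surj.
- move=> v; apply/satP; split=> [w /vP[[m' wE _] _]|w /vP[[m' wE wC] _] s sC].
    by apply/degP; exists m'.
  have [s' s'max ss'] := cone_sub_max sC.
  have /coneP := wC s' s'max; case/(_ (max_in _ s'max)) => a aa al.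
  by exists a => // i si; rewrite wE al // (subsetP ss').
- move=> f /satP[fg fC].
  (* the monomials of f outside P all lie in the ideal *)
  pose fP := laurent_filter (fun w => `[< P w >]) f.
  have fP_supp : (fP : {freeg _ / R[i]}) \in @supported_in R[i] _ P.
    by apply/asboolP => w; rewrite coeff_filter; case: asboolP => // _; rewrite eqxx.
  exists (@Sub _ _ (subm (@supported_in R[i] _ P)) _ fP_supp).
  have /laurent_incl_im[x xE] : forall w, coeff w (f - fP) != 0 ->
      exists2 a, a \in gens & forall i, ((a : 'X_{1..r}) i)%:Z <= w i.
    move=> w; rewrite coeffB coeff_filter; case: asboolP => [_|nP].
      by rewrite subrr eqxx.
    rewrite subr0 => fw; have /degP[m' wE] := fg w fw.
    apply/(generatorsP mk_ge0 wE); apply: contrapT => nT; apply: nP.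
    split=> //; exists m' => // s smax; apply/coneP; first exact: max_in.
    by rewrite -wE; apply: fC fw _ (max_in _ smax).
  by exists x; rewrite /= xE /j SubK addrC subrK.
- move=> v x vx; apply: val_inj; apply: laurentP => w; rewrite coeff0.
  apply/eqP; apply: contraT => vw.
  have [[m' wE _] nT] := vP v w vw; exfalso; apply: nT.
  apply/(generatorsP mk_ge0 wE).
  by apply: (proj1 (laurent_incl_im gens (j v))) vw; exists x.
Qed.
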